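(* Let $g_2$ be a constant parameter. The system of differential equations $$\dot x_1=-\tfrac{\mathrm{i}}{2}(x_1^2r+\gamma_3),\qquad \dot x_2=\tfrac{\mathrm{i}}{2}(x_2^2r+\gamma_3),\qquad \dot e_1=-\mathrm{i}(x_1+x_2)re_1,\qquad \dot e_2=\mathrm{i}(x_1+x_2)re_2,$$ $$\dot r=\frac{\mathrm{i}}{2}\,\frac{x_1^2-x_2^2+2e_2x_1-2e_1x_2}{(x_1+x_2)^2},\qquad \dot\gamma_3=-\frac{\mathrm{i}}{8}\,\frac{g_2(x_1^2-x_2^2)+8e_2x_1^3-8e_1x_2^3}{(x_1+x_2)^2}$$ is completely integrable on the two invariant simply-connected sets $H^+$ and $H^-$, since it has the first integrals and invariant relations $$r^2=\frac{2}{x_1+x_2}+\frac{e_1}{(x_1+x_2)^2}+\frac{e_2}{(x_1+x_2)^2},$$ $$r\gamma_3=\frac{4x_1x_2-g_2}{4(x_1+x_2)}-\frac{x_2^2e_1}{(x_1+x_2)^2}-\frac{x_1^2e_2}{(x_1+x_2)^2},$$ $$\gamma_3^2=-\frac{x_1x_2g_2}{2(x_1+x_2)}+\frac{x_2^4e_1}{(x_1+x_2)^2}+\frac{x_1^4e_2}{(x_1+x_2)^2}+\frac{g_3}{2},$$ $$e_1e_2=k^2,$$ where $g_3$ and $k$ are constants, and an invariant measure with density $\mu=\dfrac{1}{(x_1+x_2)^2}$.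
   Context: The dot denotes $d/dt$ and $\mathrm{i}$ is the imaginary unit. The variables are related to real coordinates $(p,q,r,\gamma_1,\gamma_2,\gamma_3)\in\mathbb{R}^6$ by $$x_1=p+\mathrm{i}q,\quad x_2=p-\mathrm{i}q,\quad e_1=x_1^2+\gamma_1+\mathrm{i}\gamma_2,\quad e_2=x_2^2+\gamma_1-\mathrm{i}\gamma_2,$$ with $r,\gamma_3$ unchanged. The singular hyperplane $p=0$, i.e. $x_1+x_2=0$, divides $\mathbb{R}^6$ into the half-spaces $H^+=\{p>0\}$ and $H^-=\{p<0\}$. A measure with density $\mu$ (with respect to $dx_1\,dx_2\,de_1\,de_2\,dr\,d\gamma_3$) is invariant for a vector field $X$ if $\operatorname{div}(\mu X)=0$. An invariant relation is a relation preserved by the flow (if it holds at one time on a solution, it holds at all times). ''Completely integrable'' is meant in the sense of Jacobi's theorem: the system, in six-dimensional phase space, has an invariant measure and four first integrals / invariant relations, and so is integrable by quadratures. *)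

(* Defs.v *)
From Stdlib Require Import Reals List.
From Coquelicot Require Import Coquelicot.
Import ListNotations.
Open Scope R_scope.

(* Real phase space: u = (p, q, r, gamma1, gamma2, gamma3). *)
Definition R6 : Type := (R * R * R * R * R * R)%type.

Inductive coord : Set := cx1 | cx2 | ce1 | ce2 | cr | cg.

(* Points (x1, x2, e1, e2, r, gamma3) of C^6.  The vector field, the density
   and the integrals are rational functions of six independent complex
   variables; they are evaluated on real phase space through [to_complex]. *)
Definition C6 : Type := coord -> C.

Definition to_complex (u : R6) : C6 :=
  let '(p, q, r, c1, c2, c3) := u in
  let x1 : C := (p + Ci * q)%C in
  let x2 : C := (p - Ci * q)%C in
  fun i => match i with
    | cx1 => x1
    | cx2 => x2
    | ce1 => (x1 ^ 2 + c1 + Ci * c2)%C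
    | ce2 => (x2 ^ 2 + c1 - Ci * c2)%C
    | cr => RtoC r
    | cg => RtoC c3
    end.

Definition coord_p (u : R6) : R := let '(p, _, _, _, _, _) := u in p.

Definition nonsingular (u : R6) : Prop := coord_p u <> 0.
Definition Hplus (u : R6) : Prop := 0 < coord_p u.
Definition Hminus (u : R6) : Prop := coord_p u < 0.

Definition coord_eqb (i j : coord) : bool :=
  match i, j with
  | cx1, cx1 | cx2, cx2 | ce1, ce1 | ce2, ce2 | cr, cr | cg, cg => true
  | _, _ => false
  end.

Definition upd (z : C6) (i : coord) (w : C) : C6 :=
  fun j => if coord_eqb i j then w else z j.

Definition is_partial (f : C6 -> C) (i : coord) (z : C6) (l : C) : Prop :=
  is_derive (K := C_AbsRing) (V := C_NormedModule)
    (fun w : C => f (upd z i w)) (z i) l.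

Definition is_divergence (V : C6 -> C6) (z : C6) (l : C) : Prop :=
  exists d : C6,
    (forall i, is_partial (fun w => V w i) i z (d i)) /\
    l = (d cx1 + d cx2 + d ce1 + d ce2 + d cr + d cg)%C.

(* Solutions on the open interval (a, b), possibly unbounded, staying in D;
   the complex coordinates are differentiated with respect to the real time. *)
Definition solution_in (V : C6 -> C6) (D : R6 -> Prop) (a b : Rbar)
    (u : R -> R6) : Prop :=
  forall t : R, Rbar_lt a t -> Rbar_lt t b ->
    D (u t) /\
    forall i, is_derive (K := R_AbsRing) (V := C_R_NormedModule)
                (fun s : R => to_complex (u s) i) t (V (to_complex (u t)) i).

Definition invariant_set (V : C6 -> C6) (Dom D : R6 -> Prop) : Prop :=
  forall (a b : Rbar) (u : R -> R6), solution_in V Dom a b u ->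
  forall s t : R, Rbar_lt a s -> Rbar_lt s b -> Rbar_lt a t -> Rbar_lt t b ->
  D (u s) -> D (u t).

Definition invariant_relation (V : C6 -> C6) (D : R6 -> Prop)
    (P : C6 -> Prop) : Prop :=
  forall (a b : Rbar) (u : R -> R6), solution_in V D a b u ->
  forall s t : R, Rbar_lt a s -> Rbar_lt s b -> Rbar_lt a t -> Rbar_lt t b ->
  P (to_complex (u s)) -> P (to_complex (u t)).

Definition first_integral (V : C6 -> C6) (D : R6 -> Prop)
    (f : C6 -> C) : Prop :=
  forall (a b : Rbar) (u : R -> R6), solution_in V D a b u ->
  forall s t : R, Rbar_lt a s -> Rbar_lt s b -> Rbar_lt a t -> Rbar_lt t b ->
  f (to_complex (u s)) = f (to_complex (u t)).

(* mu is the density with respect to dx1 dx2 de1 de2 dr dgamma3, which is a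
   constant multiple of the real volume form on R^6; so mu is required to be
   real and positive on D. *)
Definition invariant_measure (V : C6 -> C6) (D : R6 -> Prop)
    (mu : C6 -> C) : Prop :=
  forall u : R6, D u ->
    Im (mu (to_complex u)) = 0 /\ 0 < Re (mu (to_complex u)) /\
    is_divergence (fun w i => (mu w * V w i)%C) (to_complex u) 0.

Definition Csum (l : list C) : C := fold_right Cplus (RtoC 0) l.

(* Linear independence over C of the differentials of the functions in fs. *)
Definition independent_at (fs : list (C6 -> C)) (z : C6) : Prop :=
  exists J : nat -> C6,
    (forall j i, (j < length fs)%nat ->
       is_partial (List.nth j fs (fun _ => RtoC 0)) i z (J j i)) /\
    (forall c : nat -> C,
       (forall i, Csum (List.map (fun j => (c j * J j i)%C) (List.seq 0 (length fs)))
                  = RtoC 0) ->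
       forall j, (j < length fs)%nat -> c j = RtoC 0).

Definition zero_set (D : R6 -> Prop) (rels : list (C6 -> C)) (u : R6) : Prop :=
  D u /\ List.Forall (fun f => f (to_complex u) = RtoC 0) rels.

(* Complete integrability in the sense of Jacobi's theorem on D: an invariant
   measure and 6 - 2 = 4 invariant relations f = 0 (f in rels) or first
   integrals (in ints).  They are functionally independent: on the set cut out
   by the invariant relations, their differentials are linearly independent at
   the points of a dense subset. *)
Definition completely_integrable_with (V : C6 -> C6) (D : R6 -> Prop)
    (mu : C6 -> C) (rels ints : list (C6 -> C)) : Prop :=
  invariant_measure V D mu /\
  (length rels + length ints = 4)%nat /\
  List.Forall (fun f => invariant_relation V D (fun z => f z = RtoC 0)) rels /\
  List.Forall (first_integral V D) ints /\
  forall u : R6, zero_set D rels u ->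
  forall eps : posreal, exists v : R6,
    ball u eps v /\ zero_set D rels v /\
    independent_at (rels ++ ints) (to_complex v).

Definition unit_interval (t : R) : Prop := 0 <= t <= 1.

Definition unit_square (st : R * R) : Prop :=
  unit_interval (fst st) /\ unit_interval (snd st).

Definition path_in {T : UniformSpace} (A : T -> Prop) (x y : T)
    (c : R -> T) : Prop :=
  continuous_on unit_interval c /\ (forall t, unit_interval t -> A (c t)) /\
  c 0 = x /\ c 1 = y.

Definition simply_connected {T : UniformSpace} (A : T -> Prop) : Prop :=
  (exists x, A x) /\
  (forall x y, A x -> A y -> exists c, path_in A x y c) /\
  (forall x c, path_in A x x c ->
     exists h : R * R -> T,
       continuous_on unit_square h /\
       (forall st, unit_square st -> A (h st)) /\
       (forall s, unit_interval s -> h (s, 0) = c s /\ h (s, 1) = x) /\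
       (forall t, unit_interval t -> h (0, t) = x /\ h (1, t) = x)).

Definition vfield (g2 : R) (z : C6) : C6 :=
  let x1 := z cx1 in let x2 := z cx2 in
  let e1 := z ce1 in let e2 := z ce2 in
  let r := z cr in let g := z cg in
  fun i => match i with
    | cx1 => - (Ci / 2) * (x1 ^ 2 * r + g)
    | cx2 => Ci / 2 * (x2 ^ 2 * r + g)
    | ce1 => - Ci * (x1 + x2) * r * e1
    | ce2 => Ci * (x1 + x2) * r * e2
    | cr => Ci / 2 * ((x1 ^ 2 - x2 ^ 2 + 2 * e2 * x1 - 2 * e1 * x2)
                      / (x1 + x2) ^ 2)
    | cg => - (Ci / 8) * ((g2 * (x1 ^ 2 - x2 ^ 2) + 8 * e2 * x1 ^ 3
                           - 8 * e1 * x2 ^ 3) / (x1 + x2) ^ 2)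
    end%C.

Definition mu (z : C6) : C := (1 / (z cx1 + z cx2) ^ 2)%C.

Definition rhs_rr (z : C6) : C :=
  let x1 := z cx1 in let x2 := z cx2 in
  (2 / (x1 + x2) + z ce1 / (x1 + x2) ^ 2 + z ce2 / (x1 + x2) ^ 2)%C.

Definition rhs_rg (g2 : R) (z : C6) : C :=
  let x1 := z cx1 in let x2 := z cx2 in
  ((4 * x1 * x2 - g2) / (4 * (x1 + x2))
   - x2 ^ 2 * z ce1 / (x1 + x2) ^ 2 - x1 ^ 2 * z ce2 / (x1 + x2) ^ 2)%C.

(* Without the constant term g3 / 2. *)
Definition rhs_gg (g2 : R) (z : C6) : C :=
  let x1 := z cx1 in let x2 := z cx2 in
  (- (x1 * x2 * g2 / (2 * (x1 + x2)))
   + x2 ^ 4 * z ce1 / (x1 + x2) ^ 2 + x1 ^ 4 * z ce2 / (x1 + x2) ^ 2)%C.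

Definition rel_rr (z : C6) : Prop := (z cr ^ 2)%C = rhs_rr z.

Definition rel_rg (g2 : R) (z : C6) : Prop := (z cr * z cg)%C = rhs_rg g2 z.

Definition rel_gg (g2 g3 : R) (z : C6) : Prop :=
  (z cg ^ 2)%C = (rhs_gg g2 z + g3 / 2)%C.

Definition rel_ee (k : R) (z : C6) : Prop := (z ce1 * z ce2)%C = (k ^ 2)%C.

Definition fun_rr (z : C6) : C := (z cr ^ 2 - rhs_rr z)%C.

Definition fun_rg (g2 : R) (z : C6) : C := (z cr * z cg - rhs_rg g2 z)%C.

(* The value of g3, resp. of k ^ 2, expressed in the coordinates. *)
Definition int_g3 (g2 : R) (z : C6) : C := (2 * (z cg ^ 2 - rhs_gg g2 z))%C.

Definition int_k2 (z : C6) : C := (z ce1 * z ce2)%C.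

(* Main.v *)
Require Import Defs.
From Stdlib Require Import Reals List Lra Lia FunctionalExtensionality.
From Coquelicot Require Import Coquelicot.
Import ListNotations.
Open Scope R_scope.

(* Each of the four relations says that a rational function of the coordinates
   has a prescribed value, and the derivative of each of these functions along
   the vector field vanishes identically off x1 + x2 = 0, so all four are first
   integrals.  The coordinate p = (x1 + x2) / 2 is continuous along solutions
   and, off the singular hyperplane, cannot change sign.

   For independence put w_i = gamma3 + r x_i^2.  If r <> 0, the minor of the
   Jacobian in the columns e1, e2, r, gamma3 vanishes only if
   e1 w_2^2 = e2 w_1^2, i.e. if Im (e1 w_2^2) = 0 on real phase space.  The two
   invariant relations cut out a hypersurface in the parameters p, q, r, gamma3,
   b = Im e1, which is a graph b = b(p, q, r, gamma3) where q <> 0.  Any of its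
   points can be moved along it to one with q <> 0, then to one with r <> 0;
   finally, Im (e1 w_2^2) is on the graph a cubic polynomial in gamma3 with
   leading coefficient - p r / q, so a small change of gamma3 makes it
   nonzero. *)

(** * Derivatives of complex-valued functions *)

Notation is_derive_R f t l :=
  (@is_derive R_AbsRing C_R_NormedModule f t l).
Notation is_derive_C f z l :=
  (@is_derive C_AbsRing C_NormedModule f z l).

(** Projections and pairing are linear over the reals. This reduces the product and quotient rules
    for complex functions of a real time to the real rules. *)
Lemma is_derive_R_components (f : R -> C) (t : R) (l : C) :
  is_derive_R f t l <->
  is_derive (fun s => Re (f s)) t (Re l) /\ is_derive (fun s => Im (f s)) t (Im l).
Proof.
  split.
  - intros Hf; split.
    + apply (filterdiff_ext_lin _ (fun y : R => fst (scal y l : C_R_NormedModule))).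
      * apply (filterdiff_comp' f (fst : C_R_NormedModule -> R) t
                 (fun y => scal y l) fst Hf).
        apply filterdiff_linear, (is_linear_fst (K:=R_AbsRing)).
      * intros y; reflexivity.
    + apply (filterdiff_ext_lin _ (fun y : R => snd (scal y l : C_R_NormedModule))).
      * apply (filterdiff_comp' f (snd : C_R_NormedModule -> R) t
                 (fun y => scal y l) snd Hf).
        apply filterdiff_linear, (is_linear_snd (K:=R_AbsRing)).
      * intros y; reflexivity.
  - intros [Hr Hi].
    apply (is_derive_ext (fun s => (Re (f s), Im (f s)) : C)).
    { intros s; now destruct (f s). }
    apply (filterdiff_ext_lin _ (fun y : R => (scal y (Re l), scal y (Im l)) : C_R_NormedModule)).
    2: { intros y; destruct l; reflexivity. }
    apply (filterdiff_comp'_2 (fun s => Re (f s)) (fun s => Im (f s))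
             (fun x y : R => (x, y) : C_R_NormedModule) t
             (fun y => scal y (Re l)) (fun y => scal y (Im l)) (fun x y => (x,y)) Hr Hi).
    apply (filterdiff_ext_lin _ (fun x : C_R_NormedModule => x)).
    + apply (filterdiff_ext (fun x : C_R_NormedModule => x)).
      { now intros []. }
      apply filterdiff_id.
    + now intros [].
Qed.

Lemma is_derive_R_plus (f g : R -> C) t (df dg : C) :
  is_derive_R f t df -> is_derive_R g t dg ->
  is_derive_R (fun s => (f s + g s)%C) t (df + dg)%C.
Proof. apply (is_derive_plus (V := C_R_NormedModule)). Qed.

Lemma is_derive_R_mult (f g : R -> C) t (df dg : C) :
  is_derive_R f t df -> is_derive_R g t dg ->
  is_derive_R (fun s => (f s * g s)%C) t (df * g t + f t * dg)%C.
Proof.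
  rewrite !is_derive_R_components.
  intros [Hf1 Hf2] [Hg1 Hg2]; split; simpl.
  - evar_last.
    + apply @is_derive_minus; apply (is_derive_mult (K := R_AbsRing)); try eassumption; exact Rmult_comm.
    + unfold minus, plus, opp, mult; simpl; unfold Re, Im; ring.
  - evar_last.
    + apply @is_derive_plus; apply (is_derive_mult (K := R_AbsRing)); try eassumption; exact Rmult_comm.
    + unfold minus, plus, opp, mult; simpl; unfold Re, Im; ring.
Qed.

Lemma Re_Im_sqr_neq_0 (z : C) : z <> 0 -> Re z ^ 2 + Im z ^ 2 <> 0.
Proof.
  intros Hz E; apply Hz, Cmod_eq_0.
  apply Rsqr_0_uniq; rewrite Rsqr_pow2, Cmod2_alt; exact E.
Qed.

Lemma is_derive_R_inv (f : R -> C) t (df : C) :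
  is_derive_R f t df -> f t <> 0 ->
  is_derive_R (fun s => (/ f s)%C) t (- (df / (f t * f t)))%C.
Proof.
  intros Hf Hn.
  pose proof (Re_Im_sqr_neq_0 _ Hn) as Hn'.
  apply is_derive_R_components in Hf; destruct Hf as [Hf1 Hf2].
  assert (Hd : is_derive (fun s => Re (f s) ^ 2 + Im (f s) ^ 2) t
                 (2 * Re (f t) * Re df + 2 * Im (f t) * Im df)).
  { evar_last.
    - apply @is_derive_plus; apply is_derive_pow; eassumption.
    - unfold plus; simpl; ring. }
  (* Components of the claimed derivative over the denominator |f|^4, the form that the real
     quotient rule yields for Re f / |f|^2 and - Im f / |f|^2. *)
  assert (E : (- (df / (f t * f t)))%C
    = (-((Re df * (Re (f t)^2 - Im (f t)^2) + 2 * Im df * Re (f t) * Im (f t)) / (Re (f t) ^ 2 + Im (f t) ^ 2)^2),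
       -((Im df * (Re (f t)^2 - Im (f t)^2) - 2 * Re df * Re (f t) * Im (f t)) / (Re (f t) ^ 2 + Im (f t) ^ 2)^2))).
  { destruct (f t) as [a b], df as [c d]; unfold Re, Im in *; simpl in *.
    unfold Cdiv, Cinv, Cmult, Copp; simpl.
    replace ((a * a - b * b) * ((a * a - b * b) * 1) + (a * b + b * a) * ((a * b + b * a) * 1)) with ((a*(a*1)+b*(b*1))*(a*(a*1)+b*(b*1))) by ring.
    f_equal; field; intros E; apply Hn'; lra. }
  rewrite E; apply is_derive_R_components; split; simpl.
  - evar_last.
    + apply (is_derive_div (fun s => Re (f s)) _ t _ _ Hf1 Hd Hn').
    + unfold Re, Im in *; field; intros E'; apply Hn'; lra.
  - evar_last.
    + apply (is_derive_div (fun s => - Im (f s)) _ t _ _ (is_derive_opp _ _ _ Hf2) Hd Hn').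
    + unfold Re, Im, opp in *; simpl in *; field; intros E'; apply Hn'; lra.
Qed.

(** Both normed-module structures have the same operations and the same norm, and a derivative
    depends on nothing else. The passage lets the rules for functions into the ring be applied. *)
Lemma is_derive_C_ring (f : C -> C) (z l : C) :
  is_derive_C f z l <-> @is_derive C_AbsRing (AbsRing_NormedModule C_AbsRing) f z l.
Proof.
  split; (intros [[L1 L2 L3] H]; split; [split; [exact L1|exact L2|exact L3]|exact H]).
Qed.

Lemma is_derive_C_plus (f g : C -> C) z (df dg : C) :
  is_derive_C f z df -> is_derive_C g z dg ->
  is_derive_C (fun s => (f s + g s)%C) z (df + dg)%C.
Proof. apply (is_derive_plus (V := C_NormedModule)). Qed.

Lemma is_derive_C_mult (f g : C -> C) z (df dg : C) :
  is_derive_C f z df -> is_derive_C g z dg ->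
  is_derive_C (fun s => (f s * g s)%C) z (df * g z + f z * dg)%C.
Proof.
  rewrite !is_derive_C_ring; intros Hf Hg.
  apply (is_derive_mult (K := C_AbsRing) f g z df dg Hf Hg Cmult_comm).
Qed.

(** The remainder is exactly (y - z)^2 / (z^2 y). The first bound on |y - z| gives |y| > |z| / 2,
    and the second then makes |y - z| / (|z|^2 |y|) at most [eps]. *)
Lemma is_derive_C_Cinv (z : C) : z <> 0 -> is_derive_C Cinv z (- / (z * z))%C.
Proof.
  intros Hz; split; [apply (is_linear_scal_l (K:=C_AbsRing) (V:=C_NormedModule))|].
  intros x Hx.
  apply (@is_filter_lim_locally_unique C_AbsRing (AbsRing_NormedModule C_AbsRing)) in Hx; subst x.
  intros eps.
  assert (Hm : 0 < Cmod z) by now apply Cmod_gt_0.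
  assert (Hd : 0 < Rmin (Cmod z / 2) (eps * Cmod z ^ 3 / 2)).
  { apply Rmin_pos; [lra|].
    apply Rdiv_lt_0_compat; [|lra].
    apply Rmult_lt_0_compat; [apply cond_pos|now apply pow_lt]. }
  exists (mkposreal _ Hd); intros y Hy.
  change (Cmod (y - z) < Rmin (Cmod z / 2) (eps * Cmod z ^ 3 / 2)) in Hy.
  change (Cmod ((/ y - / z) - (y - z) * (- / (z * z)))%C <= eps * Cmod (y - z)%C).
  pose proof (Rmin_l (Cmod z / 2) (eps * Cmod z ^ 3 / 2)).
  pose proof (Rmin_r (Cmod z / 2) (eps * Cmod z ^ 3 / 2)).
  assert (Hyz : Cmod z / 2 < Cmod y).
  { pose proof (Cmod_triangle y (- (y - z))) as Ht.
    rewrite Cmod_opp in Ht; replace (y + - (y - z))%C with z in Ht by ring; lra. }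
  assert (Hy0 : (y : C) <> RtoC 0) by (apply Cmod_gt_0; lra).
  replace ((/ y - / z) - (y - z) * (- / (z * z)))%C
    with ((y - z) * ((y - z) / (z * z * y)))%C by (field; auto).
  rewrite Cmod_mult, (Rmult_comm eps).
  apply Rmult_le_compat_l; [apply Cmod_ge_0|].
  rewrite Cmod_div, !Cmod_mult by (repeat apply Cmult_neq_0; assumption).
  apply Rle_div_l; [apply Rmult_gt_0_compat; nra|].
  apply Rle_trans with (eps * Cmod z ^ 3 / 2); [lra|].
  replace (eps * Cmod z ^ 3 / 2) with (eps * (Cmod z * Cmod z * (Cmod z / 2))) by field.
  apply Rmult_le_compat_l; [apply Rlt_le, cond_pos|].
  apply Rmult_le_compat_l; nra.
Qed.

Lemma is_derive_C_inv (f : C -> C) z (df : C) :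
  is_derive_C f z df -> f z <> 0 ->
  is_derive_C (fun s => (/ f s)%C) z (- (df / (f z * f z)))%C.
Proof.
  intros Hf Hn; apply is_derive_C_ring in Hf.
  evar_last.
  - apply (is_derive_comp (V := C_NormedModule) Cinv f z _ _ (is_derive_C_Cinv _ Hn) Hf).
  - change ((df * (- / (f z * f z)))%C = (- (df / (f z * f z)))%C); unfold Cdiv; ring.
Qed.

(** * Differentials of functions of six complex variables *)

Definition unit_vec (i : coord) : C6 :=
  fun j => if coord_eqb i j then RtoC 1 else RtoC 0.

(* Complex partial derivatives alone would not give the chain rule along
   curves depending on a real time, so both are required. *)
Definition has_differential (f : C6 -> C) (z : C6) (df : C6 -> C) : Prop :=
  (forall i, is_partial f i z (df (unit_vec i))) /\
  (forall (c : R -> C6) (t : R) (v : C6), c t = z ->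
     (forall i, is_derive_R (fun s => c s i) t (v i)) ->
     is_derive_R (fun s => f (c s)) t (df v)).

Lemma upd_same (z : C6) (i : coord) : upd z i (z i) = z.
Proof.
  apply functional_extensionality; intros j; unfold upd.
  now destruct i, j.
Qed.

Lemma has_differential_coord (i : coord) z :
  has_differential (fun w => w i) z (fun v => v i).
Proof.
  split.
  - intros j; unfold is_partial, upd, unit_vec.
    destruct (coord_eqb j i).
    + apply is_derive_C_ring, (is_derive_id (K := C_AbsRing)).
    + apply (is_derive_const (V := C_NormedModule)).
  - intros c t v _ Hc; apply Hc.
Qed.

Lemma has_differential_const (a : C) z :
  has_differential (fun _ => a) z (fun _ => RtoC 0).
Proof.
  split; intros.
  - apply (is_derive_const (V := C_NormedModule)).
  - apply (is_derive_const (V := C_R_NormedModule)).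
Qed.

Lemma has_differential_plus f g z df dg :
  has_differential f z df -> has_differential g z dg ->
  has_differential (fun w => f w + g w)%C z (fun v => df v + dg v)%C.
Proof.
  intros [Hf1 Hf2] [Hg1 Hg2]; split.
  - intros i; apply (is_derive_C_plus _ _ _ _ _ (Hf1 i) (Hg1 i)).
  - intros c t v E Hc; apply is_derive_R_plus; auto.
Qed.

Lemma has_differential_mult f g z df dg :
  has_differential f z df -> has_differential g z dg ->
  has_differential (fun w => f w * g w)%C z (fun v => df v * g z + f z * dg v)%C.
Proof.
  intros [Hf1 Hf2] [Hg1 Hg2]; split.
  - intros i; pose proof (is_derive_C_mult _ _ _ _ _ (Hf1 i) (Hg1 i)) as H.
    cbv beta in H; rewrite upd_same in H; exact H.
  - intros c t v E Hc; subst z; apply is_derive_R_mult; auto.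
Qed.

Lemma has_differential_inv f z df :
  has_differential f z df -> f z <> RtoC 0 ->
  has_differential (fun w => / f w)%C z (fun v => - (df v / (f z * f z)))%C.
Proof.
  intros [Hf1 Hf2] Hn; split.
  - intros i; pose proof (is_derive_C_inv _ _ _ (Hf1 i)) as H.
    cbv beta in H; rewrite upd_same in H; exact (H Hn).
  - intros c t v E Hc; subst z; apply is_derive_R_inv; auto.
Qed.

Lemma has_differential_ext f f' z df df' :
  has_differential f z df -> (forall w, f w = f' w) -> (forall v, df v = df' v) ->
  has_differential f' z df'.
Proof.
  intros Hf Ef Ed.
  replace f' with f by now apply functional_extensionality.
  replace df' with df by now apply functional_extensionality.
  exact Hf.
Qed.

Lemma has_differential_opp f z df :
  has_differential f z df ->
  has_differential (fun w => - f w)%C z (fun v => - df v)%C.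
Proof.
  intros Hf.
  eapply has_differential_ext.
  - apply (has_differential_mult _ _ _ _ _ (has_differential_const (- (1)) z) Hf).
  - intros; simpl; ring.
  - intros; simpl; ring.
Qed.

Lemma has_differential_pow f n z df :
  has_differential f z df ->
  has_differential (fun w => f w ^ n)%C z (fun v => INR n * f z ^ pred n * df v)%C.
Proof.
  intros Hf; induction n as [|n IH].
  - eapply has_differential_ext; [apply (has_differential_const 1)|reflexivity|].
    intros; simpl; ring.
  - eapply has_differential_ext;
      [apply (has_differential_mult _ _ _ _ _ Hf IH)|reflexivity|].
    (* The case [n = 0] is separated because [pred] truncates: f * f ^ pred n is f ^ n only for
       positive n. *)
    intros v; rewrite S_INR, RtoC_plus; destruct n as [|n]; simpl; ring.
Qed.

(** The functions are extracted by higher-order patterns and passed explicitly. The differential may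
    be an existential variable, filled in on the way; only the nonvanishing of denominators remains
    to be shown. *)
Ltac differentiate :=
  lazymatch goal with
  | |- has_differential (fun w => (@?f w + @?g w)%C) _ _ =>
      apply (has_differential_plus f g); differentiate
  | |- has_differential (fun w => (@?f w - @?g w)%C) _ _ =>
      apply (has_differential_plus f (fun w => - g w)%C); differentiate
  | |- has_differential (fun w => (@?f w * @?g w)%C) _ _ =>
      apply (has_differential_mult f g); differentiate
  | |- has_differential (fun w => (@?f w / @?g w)%C) _ _ =>
      apply (has_differential_mult f (fun w => / g w)%C); differentiate
  | |- has_differential (fun w => (- @?f w)%C) _ _ =>
      apply (has_differential_opp f); differentiate
  | |- has_differential (fun w => (/ @?f w)%C) _ _ =>
      apply (has_differential_inv f); [differentiate|]
  | |- has_differential (fun w => (@?f w ^ ?n)%C) _ _ =>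
      apply (has_differential_pow f n); differentiate
  | |- has_differential (fun w => w ?i) _ _ => apply has_differential_coord
  | |- has_differential (fun _ => ?a) _ _ => apply (has_differential_const a)
  end.

Ltac neq_0 :=
  repeat first [ assumption | apply Cmult_neq_0 | apply Cpow_nz
               | (let E := fresh in intros E; apply RtoC_inj in E; lra) ].

(** * Differentials along the vector field *)

(** Here and below [z] is the base point and [v] the tangent vector: inserting the vector field
    gives the derivative along solutions, inserting [unit_vec i] a Jacobian entry. *)
Definition d_rr (z v : C6) : C :=
  let s := (z cx1 + z cx2)%C in let ds := (v cx1 + v cx2)%C in
  (2 * z cr * v cr + 2 * ds / s ^ 2 + 2 * (z ce1 + z ce2) * ds / s ^ 3
   - (v ce1 + v ce2) / s ^ 2)%C.

Definition d_rg (g2 : R) (z v : C6) : C :=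
  let x1 := z cx1 in let x2 := z cx2 in
  let s := (x1 + x2)%C in let ds := (v cx1 + v cx2)%C in
  (z cg * v cr + z cr * v cg
   - (x2 * v cx1 + x1 * v cx2) / s + (4 * x1 * x2 - g2) * ds / (4 * s ^ 2)
   + (x2 ^ 2 * v ce1 + x1 ^ 2 * v ce2) / s ^ 2
   + 2 * (x2 * z ce1 * v cx2 + x1 * z ce2 * v cx1) / s ^ 2
   - 2 * (x2 ^ 2 * z ce1 + x1 ^ 2 * z ce2) * ds / s ^ 3)%C.

Definition d_g3 (g2 : R) (z v : C6) : C :=
  let x1 := z cx1 in let x2 := z cx2 in
  let s := (x1 + x2)%C in let ds := (v cx1 + v cx2)%C in
  (4 * z cg * v cg
   + g2 * ((x2 * v cx1 + x1 * v cx2) / s - x1 * x2 * ds / s ^ 2)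
   - 2 * (x2 ^ 4 * v ce1 + x1 ^ 4 * v ce2) / s ^ 2
   - 8 * (x2 ^ 3 * z ce1 * v cx2 + x1 ^ 3 * z ce2 * v cx1) / s ^ 2
   + 4 * (x2 ^ 4 * z ce1 + x1 ^ 4 * z ce2) * ds / s ^ 3)%C.

Definition d_k2 (z v : C6) : C := (z ce2 * v ce1 + z ce1 * v ce2)%C.

Section Differentials.

Variables (g2 : R) (z : C6).
Hypothesis hs : (z cx1 + z cx2)%C <> RtoC 0.

Lemma has_differential_rr : has_differential fun_rr z (d_rr z).
Proof.
  eapply has_differential_ext; [|intros; unfold fun_rr, rhs_rr; reflexivity|].
  - differentiate; neq_0.
  - intros v; unfold d_rr; simpl INR; simpl pred; rewrite ?RtoC_plus; field; auto.
Qed.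

Lemma has_differential_rg : has_differential (fun_rg g2) z (d_rg g2 z).
Proof.
  eapply has_differential_ext; [|intros; unfold fun_rg, rhs_rg; reflexivity|].
  - differentiate; neq_0.
  - intros v; unfold d_rg; simpl INR; simpl pred; rewrite ?RtoC_plus; field; auto.
Qed.

Lemma has_differential_g3 : has_differential (int_g3 g2) z (d_g3 g2 z).
Proof.
  eapply has_differential_ext; [|intros; unfold int_g3, rhs_gg; reflexivity|].
  - differentiate; neq_0.
  - intros v; unfold d_g3; simpl INR; simpl pred; rewrite ?RtoC_plus; field; auto.
Qed.

Lemma has_differential_k2 : has_differential int_k2 z (d_k2 z).
Proof.
  eapply has_differential_ext; [|intros; unfold int_k2; reflexivity|].
  - differentiate.
  - intros v; unfold d_k2; simpl; ring.
Qed.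

(** A rational identity in six independent complex variables, so that [fun_rr] is conserved at every
    value and not only at 0. *)
Lemma d_rr_vfield : d_rr z (vfield g2 z) = RtoC 0.
Proof. unfold d_rr, vfield; field; auto. Qed.

Lemma d_rg_vfield : d_rg g2 z (vfield g2 z) = RtoC 0.
Proof. unfold d_rg, vfield; field; auto. Qed.

Lemma d_g3_vfield : d_g3 g2 z (vfield g2 z) = RtoC 0.
Proof. unfold d_g3, vfield; field; auto. Qed.

(** The logarithmic derivatives of e1 and e2 along the field are opposite. *)
Lemma d_k2_vfield : d_k2 z (vfield g2 z) = RtoC 0.
Proof. unfold d_k2, vfield; ring. Qed.

(** The r and gamma3 components do not contain their own variable and contribute 0, the e1 and e2
    terms cancel each other, and the x1 and x2 terms cancel because (x1^2 - x2^2) / s^3 = (x1 - x2)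
    / s^2 with s = x1 + x2. *)
Lemma div_mu_vfield : is_divergence (fun w i => mu w * vfield g2 w i)%C z 0.
Proof.
  set (x1 := z cx1) in *; set (x2 := z cx2) in *; set (r := z cr); set (g := z cg).
  set (s := (x1 + x2)%C) in *.
  exists (fun i => match i with
    | cx1 => - Ci * (x1 * r / s ^ 2 - (x1 ^ 2 * r + g) / s ^ 3)
    | cx2 => Ci * (x2 * r / s ^ 2 - (x2 ^ 2 * r + g) / s ^ 3)
    | ce1 => - Ci * r / s
    | ce2 => Ci * r / s
    | _ => 0
    end)%C.
  split; [|subst s; field; auto].
  (* The differential is kept existential so that [differentiate] can construct it; only its value
     on [unit_vec i] is then compared with the entry above. *)
  assert (H : forall i l, (exists df, has_differential (fun w => mu w * vfield g2 w i)%C z df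
                /\ df (unit_vec i) = l) ->
     is_partial (fun w => mu w * vfield g2 w i)%C i z l).
  { intros i l (df & [Hd _] & <-); apply Hd. }
  intros i; apply H; unfold mu, vfield; destruct i; eexists; split;
    try (differentiate; neq_0); unfold unit_vec; cbv [coord_eqb];
    fold x1 x2 r g; fold s; simpl INR; simpl pred; rewrite ?RtoC_plus; subst s; field; auto.
Qed.

End Differentials.

(** * First integrals and the half-spaces *)

Lemma sum_x_to_complex (u : R6) :
  (to_complex u cx1 + to_complex u cx2)%C = RtoC (2 * coord_p u).
Proof.
  destruct u as [[[[[p q] r] c1] c2] c3]; simpl.
  rewrite RtoC_mult; ring.
Qed.

Lemma sum_x_neq_0 (u : R6) :
  nonsingular u -> (to_complex u cx1 + to_complex u cx2)%C <> RtoC 0.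
Proof.
  rewrite sum_x_to_complex; intros Hu E; apply RtoC_inj in E.
  unfold nonsingular in Hu; lra.
Qed.

Lemma half_space_nonsingular (D : R6 -> Prop) :
  D = Hplus \/ D = Hminus -> forall u, D u -> nonsingular u.
Proof.
  intros [-> | ->] u; unfold Hplus, Hminus, nonsingular; lra.
Qed.

Lemma solution_in_between (a b : Rbar) (s t x : R) :
  Rbar_lt a s -> Rbar_lt t b -> s <= x <= t -> Rbar_lt a x /\ Rbar_lt x b.
Proof.
  intros Ha Hb [H1 H2]; split.
  - eapply Rbar_lt_le_trans; [exact Ha|]; exact H1.
  - eapply Rbar_le_lt_trans; [|exact Hb]; exact H2.
Qed.

(** The second clause of [has_differential] is the chain rule along a solution; a curve with zero
    derivative is constant. *)
Lemma first_integral_of_differential (V : C6 -> C6) (D : R6 -> Prop)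
    (f : C6 -> C) (df : C6 -> C6 -> C) :
  (forall u, D u -> has_differential f (to_complex u) (df (to_complex u))) ->
  (forall u, D u -> df (to_complex u) (V (to_complex u)) = RtoC 0) ->
  first_integral V D f.
Proof.
  intros Hdf H0 a b u Hu.
  assert (Hlt : forall s t : R, Rbar_lt a s -> Rbar_lt t b -> s < t ->
            f (to_complex (u s)) = f (to_complex (u t))).
  { intros s t Ha Hb Hst.
    apply (eq_is_derive (V := C_R_NormedModule) (fun x => f (to_complex (u x)))); [|exact Hst].
    intros x Hx; destruct (solution_in_between a b s t x Ha Hb Hx) as [Hax Hxb].
    destruct (Hu x Hax Hxb) as [HD Hd].
    change (@zero C_R_NormedModule) with (RtoC 0); rewrite <- (H0 _ HD).
    now apply (Hdf _ HD). }
  intros s t Has Hsb Hat Htb.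
  destruct (Rtotal_order s t) as [H|[->|H]]; [|reflexivity|symmetry]; now apply Hlt.
Qed.

Lemma invariant_relation_of_first_integral (V : C6 -> C6) (D : R6 -> Prop)
    (f : C6 -> C) (c : C) (P : C6 -> Prop) :
  (forall z, P z <-> f z = c) -> first_integral V D f -> invariant_relation V D P.
Proof.
  intros HP Hf a b u Hu s t Has Hsb Hat Htb; rewrite !HP; intros <-.
  symmetry; now apply (Hf a b u Hu).
Qed.

Lemma solution_coord_p_continuous (V : C6 -> C6) (D : R6 -> Prop) (a b : Rbar)
    (u : R -> R6) (t : R) :
  solution_in V D a b u -> Rbar_lt a t -> Rbar_lt t b ->
  continuous (fun s => coord_p (u s)) t.
Proof.
  intros Hu Ha Hb; destruct (Hu t Ha Hb) as [_ Hd].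
  specialize (Hd cx1); apply is_derive_R_components in Hd; destruct Hd as [Hd _].
  apply (ex_derive_continuous (V := R_NormedModule)).
  eexists; eapply is_derive_ext; [|exact Hd].
  intros s; cbv beta; destruct (u s) as [[[[[p q] r] c1] c2] c3].
  simpl; ring.
Qed.

(** The product form treats both half-spaces at once: a change of sign would force a zero of p at an
    intermediate time. *)
Lemma solution_coord_p_sign (V : C6 -> C6) (a b : Rbar) (u : R -> R6) (s t : R) :
  solution_in V nonsingular a b u ->
  Rbar_lt a s -> Rbar_lt s b -> Rbar_lt a t -> Rbar_lt t b ->
  0 < coord_p (u s) * coord_p (u t).
Proof.
  intros Hu.
  assert (Hlt : forall s t : R, Rbar_lt a s -> Rbar_lt t b -> s < t ->
            0 < coord_p (u s) * coord_p (u t)).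
  { clear s t; intros s t Ha Hb Hst.
    apply Rnot_le_lt; intros Hle.
    assert (Hc : forall x, s <= x <= t ->
                continuous (fun s => coord_p (u s)) x /\ coord_p (u x) <> 0).
    { intros x Hx; destruct (solution_in_between a b s t x Ha Hb Hx) as [Hax Hxb].
      split; [now apply (solution_coord_p_continuous V nonsingular a b)|].
      now apply (Hu x). }
    assert (Hs : coord_p (u s) <> 0) by (apply (Hc s); lra).
    assert (Ht : coord_p (u t) <> 0) by (apply (Hc t); lra).
    (* The factor - p(s) makes this function negative at s whatever the sign of p(s), and positive
       at t under the assumption to be refuted. *)
    destruct (Ranalysis5.IVT_interv (fun x => - coord_p (u s) * coord_p (u x)) s t)
      as (x & Hx & E).
    - intros x Hx; apply continuity_pt_filterlim.
      apply (continuous_scal_r (V := R_NormedModule) _ (fun x => coord_p (u x))), Hc, Hx.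
    - exact Hst.
    - nra.
    - pose proof (Rmult_integral_contrapositive _ _ (conj Hs Ht)); lra.
    - now apply Rmult_integral in E as [E|E]; [lra|apply (Hc x)]. }
  intros Has Hsb Hat Htb.
  destruct (Rtotal_order s t) as [H|[->|H]].
  - now apply Hlt.
  - pose proof (proj1 (Hu t Hat Htb)); unfold nonsingular in *.
    destruct (Rtotal_order (coord_p (u t)) 0) as [?|[?|?]]; [nra|contradiction|nra].
  - rewrite Rmult_comm; now apply Hlt.
Qed.

Lemma half_space_invariant (V : C6 -> C6) (D : R6 -> Prop) :
  D = Hplus \/ D = Hminus -> invariant_set V nonsingular D.
Proof.
  intros HD a b u Hu s t Has Hsb Hat Htb.
  pose proof (solution_coord_p_sign V a b u s t Hu Has Hsb Hat Htb).
  destruct HD as [-> | ->]; unfold Hplus, Hminus; nra.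
Qed.

(** * Simple connectedness of convex sets *)

Lemma continuous_on_comp {T U W : UniformSpace} (A : T -> Prop) (B : U -> Prop)
    (f : T -> U) (g : U -> W) :
  continuous_on A f -> (forall x, A x -> B (f x)) -> continuous_on B g ->
  continuous_on A (fun x => g (f x)).
Proof.
  intros Hf HAB Hg x Hx P HP.
  specialize (Hg (f x) (HAB x Hx) P HP).
  specialize (Hf x Hx _ Hg).
  unfold filtermap, within in *.
  revert Hf; apply filter_imp; auto.
Qed.

Section Convex.

Context {V : NormedModule R_AbsRing}.

Definition segment (x y : V) (t : R) : V := plus (scal (1 - t) x) (scal t y).

Definition convex (A : V -> Prop) : Prop :=
  forall x y t, A x -> A y -> unit_interval t -> A (segment x y t).

Lemma segment_same (x : V) (t : R) : segment x x t = x.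
Proof.
  unfold segment; rewrite <- scal_distr_r.
  transitivity (scal (one : R_AbsRing) x); [|apply (scal_one (K := R_AbsRing))].
  f_equal; unfold plus, one; simpl; ring.
Qed.

Lemma segment_0 (x y : V) : segment x y 0 = x.
Proof.
  unfold segment; rewrite Rminus_0_r, (scal_zero_l (K := R_AbsRing)), plus_zero_r.
  apply (scal_one (K := R_AbsRing)).
Qed.

Lemma segment_1 (x y : V) : segment x y 1 = y.
Proof.
  unfold segment; rewrite Rminus_diag, (scal_zero_l (K := R_AbsRing)), plus_zero_l.
  apply (scal_one (K := R_AbsRing)).
Qed.

(** The arbitrary filter lets this serve both a path on the interval and a homotopy on the
    square. *)
Lemma filterlim_segment {T : Type} (F : (T -> Prop) -> Prop) {FF : Filter F}
    (f g : T -> V) (h : T -> R) (x y : V) (t : R) :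
  filterlim f F (locally x) -> filterlim g F (locally y) -> filterlim h F (locally t) ->
  filterlim (fun w => segment (f w) (g w) (h w)) F (locally (segment x y t)).
Proof.
  intros Hf Hg Hh; unfold segment.
  assert (Hs : forall (f' : T -> V) (h' : T -> R) (x' : V) (t' : R),
            filterlim f' F (locally x') -> filterlim h' F (locally t') ->
            filterlim (fun w => scal (h' w) (f' w)) F (locally (scal t' x'))).
  { intros f' h' x' t' Hf' Hh'.
    exact (filterlim_comp_2 _ _ _ Hh' Hf' (filterlim_scal (K := R_AbsRing) t' x')). }
  refine (filterlim_comp_2 _ _ _ (Hs _ _ _ _ Hf _) (Hs _ _ _ _ Hg Hh) (filterlim_plus _ _)).
  refine (filterlim_comp _ _ _ h (fun s => 1 - s) _ _ _ Hh _).
  apply (continuous_minus (V := R_NormedModule) (fun _ => 1) (fun s : R => s) t);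
    [apply continuous_const|apply continuous_id].
Qed.

(** Segments join points, and the straight-line homotopy (1 - t) c(s) + t x contracts a loop; it
    fixes the base point since [c 0] and [c 1] equal [x]. *)
Lemma convex_simply_connected (A : V -> Prop) :
  (exists x, A x) -> convex A -> simply_connected A.
Proof.
  intros HA HC; split; [exact HA|split].
  - intros x y Hx Hy; exists (segment x y); split; [|split; [|split]].
    + intros t Ht; apply filterlim_segment; try typeclasses eauto;
        try apply filterlim_const.
      apply (filterlim_filter_le_1 (F := locally t)); [|apply filterlim_id].
      apply filter_le_within.
    + intros t Ht; now apply HC.
    + apply segment_0.
    + apply segment_1.
  - intros x c (Hc & HcA & H0 & H1).
    assert (Hx : A x) by (rewrite <- H0; apply HcA; unfold unit_interval; lra).
    exists (fun st => segment (c (fst st)) x (snd st)); split; [|split; [|split]].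
    + intros [s t] [Hs Ht]; simpl in *.
      apply filterlim_segment; try typeclasses eauto; [|apply filterlim_const|].
      (* [c] is continuous only relative to the unit interval, so [fst] must map the square into
         it. *)
      * apply (continuous_on_comp unit_square unit_interval fst c); [|now intros ? []|exact Hc|now split].
        intros [s' t'] _; eapply filterlim_filter_le_1; [apply filter_le_within|apply continuous_fst].
      * eapply filterlim_filter_le_1; [apply filter_le_within|apply continuous_snd].
    + intros [s t] [Hs Ht]; apply HC; auto.
    + intros s Hs; simpl; split; [apply segment_0|apply segment_1].
    + intros t Ht; simpl; rewrite H0, H1; split; apply segment_same.
Qed.

End Convex.

(** The nesting follows the left-associated tuples of [R6], so that carrier and uniform structure
    agree with those of phase space by conversion. *)
Definition R6_NormedModule : NormedModule R_AbsRing :=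
  prod_NormedModule R_AbsRing (prod_NormedModule R_AbsRing (prod_NormedModule R_AbsRing
    (prod_NormedModule R_AbsRing (prod_NormedModule R_AbsRing
       R_NormedModule R_NormedModule) R_NormedModule) R_NormedModule) R_NormedModule)
    R_NormedModule.

Lemma half_space_simply_connected (D : R6 -> Prop) :
  D = Hplus \/ D = Hminus -> simply_connected D.
Proof.
  intros HD; apply (convex_simply_connected (V := R6_NormedModule)).
  - destruct HD as [-> | ->].
    + exists (1, 0, 0, 0, 0, 0); unfold Hplus; simpl; lra.
    + exists (-1, 0, 0, 0, 0, 0); unfold Hminus; simpl; lra.
  - intros x y t Hx Hy [H0 H1].
    assert (E : coord_p (segment (V := R6_NormedModule) x y t)
                = (1 - t) * coord_p x + t * coord_p y).
    { destruct x as [[[[[p q] r] c1] c2] c3], y as [[[[[p' q'] r'] c1'] c2'] c3'].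
      reflexivity. }
    destruct HD as [-> | ->]; unfold Hplus, Hminus in *; rewrite E; nra.
Qed.

(** * Functional independence *)

(** Columns gamma3 and r express [c1] and [c0] through [c2]; columns e1 and e2 then become a
    homogeneous system for [c2] and [c3] whose determinant is a nonzero multiple of
    [e1 * w2 ^ 2 - e2 * w1 ^ 2]. *)
Lemma independent_of_nondegenerate (g2 : R) (z : C6) :
  (z cx1 + z cx2)%C <> RtoC 0 -> z cr <> RtoC 0 ->
  (z ce1 * (z cg + z cr * z cx2 ^ 2) ^ 2)%C <> (z ce2 * (z cg + z cr * z cx1 ^ 2) ^ 2)%C ->
  independent_at [fun_rr; fun_rg g2; int_g3 g2; int_k2] z.
Proof.
  intros hs hr hne.
  exists (fun j i => match j with
    | 0 => d_rr z (unit_vec i) | 1 => d_rg g2 z (unit_vec i)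
    | 2 => d_g3 g2 z (unit_vec i) | _ => d_k2 z (unit_vec i) end)%nat.
  split.
  - intros j i hj; simpl in hj.
    destruct j as [|[|[|[|j]]]]; simpl; [| | | |lia].
    + now apply has_differential_rr.
    + now apply has_differential_rg.
    + now apply has_differential_g3.
    + now apply has_differential_k2.
  - intros c Hc.
    pose proof (Hc cr) as Hr; pose proof (Hc cg) as Hg.
    pose proof (Hc ce1) as H1; pose proof (Hc ce2) as H2; clear Hc.
    unfold Csum, d_rr, d_rg, d_g3, d_k2, unit_vec in Hr, Hg, H1, H2.
    cbn [List.map List.seq List.length List.fold_right coord_eqb] in Hr, Hg, H1, H2.
    set (x1 := z cx1) in *; set (x2 := z cx2) in *; set (e1 := z ce1) in *.
    set (e2 := z ce2) in *; set (r := z cr) in *; set (g := z cg) in *.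
    set (c0 := c 0%nat) in *; set (c1 := c 1%nat) in *.
    set (c2 := c 2%nat) in *; set (c3 := c 3%nat) in *.
    set (w1 := (g + r * x1 ^ 2)%C) in *; set (w2 := (g + r * x2 ^ 2)%C) in *.
    assert (h2 : RtoC 2 <> RtoC 0) by neq_0.
    assert (hne' : (e1 * w2 ^ 2 - e2 * w1 ^ 2)%C <> RtoC 0).
    { intros E; apply hne.
      transitivity (e1 * w2 ^ 2 - e2 * w1 ^ 2 + e2 * w1 ^ 2)%C; [ring|rewrite E; ring]. }
    assert (E1 : c1 = (- (4 * g * c2 / r))%C).
    { transitivity ((c1 * r + c2 * 4 * g - c2 * 4 * g) / r)%C; [field; auto|].
      replace (c1 * r + c2 * 4 * g)%C with (RtoC 0); [field; auto|].
      rewrite <- Hg; field; auto. }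
    assert (E0 : c0 = (2 * g ^ 2 * c2 / r ^ 2)%C).
    { transitivity ((c0 * 2 * r + c1 * g - c1 * g) / (2 * r))%C; [field; auto|].
      replace (c0 * 2 * r + c1 * g)%C with (RtoC 0).
      - rewrite E1; field; auto.
      - rewrite <- Hr; field; auto. }
    (* After the substitution the terms with [c2] combine to the perfect square g^2 + 2 g r x2^2 +
       r^2 x2^4 = w2^2; likewise with [x1] in [F2]. *)
    assert (F1 : (c3 * e2 - 2 * c2 * w2 ^ 2 / (r ^ 2 * (x1 + x2) ^ 2))%C = RtoC 0).
    { rewrite <- H1, E0, E1; unfold w2; field; auto. }
    assert (F2 : (c3 * e1 - 2 * c2 * w1 ^ 2 / (r ^ 2 * (x1 + x2) ^ 2))%C = RtoC 0).
    { rewrite <- H2, E0, E1; unfold w1; field; auto. }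
    (* Cramer's rule for the two equations [F1] and [F2]. *)
    assert (Z3 : c3 = RtoC 0).
    { transitivity ((w2 ^ 2 * (c3 * e1 - 2 * c2 * w1 ^ 2 / (r ^ 2 * (x1 + x2) ^ 2))
                     - w1 ^ 2 * (c3 * e2 - 2 * c2 * w2 ^ 2 / (r ^ 2 * (x1 + x2) ^ 2)))
                    / (e1 * w2 ^ 2 - e2 * w1 ^ 2))%C; [field; auto|].
      rewrite F1, F2; field; auto. }
    assert (Z2 : c2 = RtoC 0).
    { transitivity ((e2 * (c3 * e1 - 2 * c2 * w1 ^ 2 / (r ^ 2 * (x1 + x2) ^ 2))
                     - e1 * (c3 * e2 - 2 * c2 * w2 ^ 2 / (r ^ 2 * (x1 + x2) ^ 2)))
                    * (r ^ 2 * (x1 + x2) ^ 2) / (2 * (e1 * w2 ^ 2 - e2 * w1 ^ 2)))%C;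
        [field; auto|].
      rewrite F1, F2; field; auto. }
    intros j hj; simpl in hj.
    destruct j as [|[|[|[|j]]]]; [| | | |lia].
    + fold c0; rewrite E0, Z2; field; auto.
    + fold c1; rewrite E1, Z2; field; auto.
    + exact Z2.
    + exact Z3.
Qed.

(* On [p <> 0] the relation [fun_rr = 0] determines Re e1; the remaining
   parameters of its solution set are p, q, r, gamma3 and [b] = Im e1. *)
Definition rr_point (p q r g b : R) : R6 :=
  (p, q, r, 2 * p ^ 2 * r ^ 2 - 2 * p - (p ^ 2 - q ^ 2), b - 2 * p * q, g).

(* [2 p * fun_rg] on [rr_point]. *)
Definition rg_poly (g2 p q r g b : R) : R :=
  2 * p * r * g - (p ^ 2 + q ^ 2) + g2 / 4 + (p ^ 2 - q ^ 2) * (2 * p * r ^ 2 - 2)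
  + 2 * q * b.

(** [rr_point] subtracts the real and imaginary parts of x1^2 = p^2 - q^2 + 2 i p q. On real phase
    space e2 is the conjugate of e1. *)
Lemma e1_rr_point (p q r g b : R) :
  to_complex (rr_point p q r g b) ce1 = (2 * p ^ 2 * r ^ 2 - 2 * p, b).
Proof. apply injective_projections; simpl; ring. Qed.

Lemma e2_rr_point (p q r g b : R) :
  to_complex (rr_point p q r g b) ce2 = (2 * p ^ 2 * r ^ 2 - 2 * p, - b).
Proof. apply injective_projections; simpl; ring. Qed.

Lemma double_neq_0 (p : R) : p <> 0 -> 2 * p <> 0.
Proof. intros Hp E; apply Hp; lra. Qed.

Lemma fun_rr_eq_0 (u : R6) :
  nonsingular u -> fun_rr (to_complex u) = RtoC 0 ->
  exists p q r g b, u = rr_point p q r g b.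
Proof.
  intros Hu H.
  pose proof (sum_x_to_complex u) as Hs.
  unfold fun_rr, rhs_rr in H; rewrite Hs in H.
  destruct u as [[[[[p q] r] c1] c2] c3]; unfold nonsingular in Hu; simpl coord_p in *.
  exists p, q, r, c3, (c2 + 2 * p * q); unfold rr_point.
  assert (E : c1 = 2 * p ^ 2 * r ^ 2 - 2 * p - (p ^ 2 - q ^ 2)).
  (* As e1 and e2 are conjugate, their sum is real and [fun_rr = 0] is one real equation, linear in
     [c1] once multiplied by 2 p^2. *)
  { assert (E : (to_complex (p, q, r, c1, c2, c3) ce1
                 + to_complex (p, q, r, c1, c2, c3) ce2)%C
                = RtoC (2 * (p ^ 2 - q ^ 2 + c1))).
    { apply injective_projections; simpl; ring. }
    assert (H' : RtoC (r ^ 2 - 2 / (2 * p) - 2 * (p ^ 2 - q ^ 2 + c1) / (2 * p) ^ 2) = RtoC 0).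
    { rewrite <- H.
      unfold Rdiv; rewrite !RtoC_minus, (RtoC_mult (2 * (p ^ 2 - q ^ 2 + c1))), <- E.
      rewrite RtoC_mult, !RtoC_inv, !RtoC_pow by auto using pow_nonzero, double_neq_0.
      change (to_complex (p, q, r, c1, c2, c3) cr) with (RtoC r).
      unfold Cdiv; ring. }
    apply RtoC_inj in H'.
    assert (H'' : (r ^ 2 - 2 / (2 * p) - 2 * (p ^ 2 - q ^ 2 + c1) / (2 * p) ^ 2) * (2 * p ^ 2) = 0)
      by (rewrite H'; ring).
    field_simplify in H''; [lra|exact Hu]. }
  rewrite E; repeat f_equal; ring.
Qed.

Lemma fun_rr_rr_point (p q r g b : R) :
  p <> 0 -> fun_rr (to_complex (rr_point p q r g b)) = RtoC 0.
Proof.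
  intros Hp; unfold fun_rr, rhs_rr.
  rewrite sum_x_to_complex, e1_rr_point, e2_rr_point; simpl coord_p.
  change (to_complex (rr_point p q r g b) cr) with (RtoC r).
  unfold Cdiv; rewrite <- RtoC_pow, <- !RtoC_inv, <- RtoC_pow
    by auto using pow_nonzero, double_neq_0.
  apply injective_projections; simpl; field; exact Hp.
Qed.

(** The terms x2^2 e1 and x1^2 e2 are conjugate, so [fun_rg] is real here and vanishes under a
    single real condition. *)
Lemma fun_rg_rr_point (g2 p q r g b : R) :
  p <> 0 ->
  fun_rg g2 (to_complex (rr_point p q r g b)) = RtoC (rg_poly g2 p q r g b / (2 * p)).
Proof.
  intros Hp; unfold fun_rg, rhs_rg.
  rewrite sum_x_to_complex, e1_rr_point, e2_rr_point; simpl coord_p.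
  unfold Cdiv; rewrite <- RtoC_pow, <- RtoC_mult, <- !RtoC_inv
    by auto using pow_nonzero, double_neq_0.
  unfold rg_poly; apply injective_projections; simpl; field; exact Hp.
Qed.

Lemma zero_set_rr_point (g2 : R) (D : R6 -> Prop) (p q r g b : R) :
  p <> 0 ->
  zero_set D [fun_rr; fun_rg g2] (rr_point p q r g b) <->
  D (rr_point p q r g b) /\ rg_poly g2 p q r g b = 0.
Proof.
  intros Hp; unfold zero_set.
  rewrite !Forall_cons_iff, fun_rr_rr_point, fun_rg_rr_point by exact Hp.
  split.
  - intros (HD & _ & H & _); split; [exact HD|].
    apply RtoC_inj in H.
    replace (rg_poly g2 p q r g b) with (rg_poly g2 p q r g b / (2 * p) * (2 * p)) by (field; exact Hp).
    rewrite H; ring.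
  - intros [HD H]; split; [exact HD|]; split; [reflexivity|].
    rewrite H; split; [f_equal; field; exact Hp|constructor].
Qed.

(* Im (e1 (gamma3 + r x2^2)^2) on [rr_point]. *)
Definition degeneracy (p q r g b : R) : R :=
  b * ((g + r * (p ^ 2 - q ^ 2)) ^ 2 - (2 * p * q * r) ^ 2)
  - 2 * (2 * p ^ 2 * r ^ 2 - 2 * p) * (g + r * (p ^ 2 - q ^ 2)) * (2 * p * q * r).

(** The two quantities to be separated are complex conjugates, so they differ as soon as the
    imaginary part of one is nonzero. *)
Lemma rr_point_independent (g2 p q r g b : R) :
  p <> 0 -> r <> 0 -> degeneracy p q r g b <> 0 ->
  independent_at [fun_rr; fun_rg g2; int_g3 g2; int_k2]
    (to_complex (rr_point p q r g b)).
Proof.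
  intros Hp Hr Hd; apply independent_of_nondegenerate.
  - now apply sum_x_neq_0.
  - intros E; exact (Hr (RtoC_inj r 0 E)).
  - rewrite e1_rr_point, e2_rr_point; intros E; apply Hd.
    apply (f_equal Im) in E.
    unfold degeneracy; simpl in E; lra.
Qed.

(** * Adherent points and small perturbations *)

Definition adherent {T : UniformSpace} (A : T -> Prop) (x : T) : Prop :=
  forall eps : posreal, exists y, ball x eps y /\ A y.

Lemma adherent_in {T : UniformSpace} (A : T -> Prop) (x : T) : A x -> adherent A x.
Proof. intros Hx eps; exists x; split; [apply ball_center|exact Hx]. Qed.

(** This lets the genericity conditions be reached one after another, each by its own small move. *)
Lemma adherent_trans {T : UniformSpace} (A B : T -> Prop) (x : T) :
  adherent A x -> (forall y, A y -> adherent B y) -> adherent B x.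
Proof.
  intros HA HB eps.
  destruct (HA (pos_div_2 eps)) as (y & Hxy & Hy).
  destruct (HB y Hy (pos_div_2 eps)) as (z & Hyz & Hz).
  exists z; split; [|exact Hz].
  rewrite <- (Rplus_half_diag eps); exact (ball_triangle _ _ _ _ _ Hxy Hyz).
Qed.

Lemma adherent_curve {T : UniformSpace} (A : T -> Prop) (c : R -> T) :
  continuous c 0 ->
  (forall d : posreal, exists t, Rabs t < d /\ A (c t)) ->
  adherent A (c 0).
Proof.
  intros Hc HA eps.
  destruct (Hc _ (locally_ball (c 0) eps)) as [d Hd].
  destruct (HA d) as (t & Ht & HAt).
  exists (c t); split; [apply Hd|exact HAt].
  change (Rabs (t - 0) < d); now rewrite Rminus_0_r.
Qed.

Lemma continuous_pair {T U W : UniformSpace} (f : T -> U) (g : T -> W) (x : T) :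
  continuous f x -> continuous g x -> continuous (fun t => (f t, g t)) x.
Proof.
  intros Hf Hg P [eps HP]; unfold filtermap.
  apply (filter_imp (fun t => ball (f x) eps (f t) /\ ball (g x) eps (g t))).
  - intros t [H1 H2]; apply HP; now split.
  - apply filter_and; [apply (Hf _ (locally_ball _ eps))|apply (Hg _ (locally_ball _ eps))].
Qed.

Lemma continuous_rr_point (p q r g b : R -> R) (t : R) :
  ex_derive p t -> ex_derive q t -> ex_derive r t -> ex_derive g t -> ex_derive b t ->
  continuous (fun s => rr_point (p s) (q s) (r s) (g s) (b s)) t.
Proof.
  intros Hp Hq Hr Hg Hb; unfold rr_point.
  repeat apply @continuous_pair; apply (ex_derive_continuous (V := R_NormedModule));
    auto_derive; repeat split; assumption.
Qed.

(** The third difference of the cubic at h, 2h, 3h, 4h equals 6 k3 h^3, so it cannot vanish at all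
    four; h = d / 5 keeps them within distance d of 0. *)
Lemma cubic_frequently_neq_0 (k0 k1 k2 k3 : R) (d : posreal) :
  k3 <> 0 ->
  exists t, Rabs t < d /\ k0 + k1 * t + k2 * t ^ 2 + k3 * t ^ 3 <> 0.
Proof.
  intros Hk; pose proof (cond_pos d) as Hd.
  set (h := d / 5); set (P := fun t => k0 + k1 * t + k2 * t ^ 2 + k3 * t ^ 3).
  assert (Hh : 0 < h) by (unfold h; lra).
  assert (H3 : P (4 * h) - 3 * P (3 * h) + 3 * P (2 * h) - P (1 * h) <> 0).
  { replace (_ - P (1 * h)) with (6 * (k3 * h ^ 3)) by (unfold P; ring).
    apply Rmult_integral_contrapositive_currified; [lra|].
    apply Rmult_integral_contrapositive_currified; [exact Hk|].
    apply pow_nonzero; lra. }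
  assert (Hex : exists n, 1 <= n <= 4 /\ P (n * h) <> 0).
  { destruct (Req_dec (P (1 * h)) 0) as [E1|N]; [|exists 1; lra].
    destruct (Req_dec (P (2 * h)) 0) as [E2|N]; [|exists 2; lra].
    destruct (Req_dec (P (3 * h)) 0) as [E3|N]; [|exists 3; lra].
    destruct (Req_dec (P (4 * h)) 0) as [E4|N]; [|exists 4; lra].
    exfalso; apply H3; rewrite E1, E2, E3, E4; ring. }
  destruct Hex as (n & Hn & HP).
  exists (n * h); split; [|exact HP].
  rewrite Rabs_pos_eq by nra; unfold h in *; nra.
Qed.

(** * Density of the nondegenerate points in the zero set *)

Section Density.

Variables (g2 : R) (D : R6 -> Prop).
Hypothesis hD : D = Hplus \/ D = Hminus.

Lemma half_space_rr_point (p q r g b p' q' r' g' b' : R) :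
  0 < p * p' -> D (rr_point p q r g b) -> D (rr_point p' q' r' g' b').
Proof.
  destruct hD as [-> | ->]; unfold Hplus, Hminus; simpl; nra.
Qed.

Lemma rr_point_p_neq_0 (p q r g b : R) : D (rr_point p q r g b) -> p <> 0.
Proof. apply half_space_nonsingular, hD. Qed.

Definition zero_point (p q r g b : R) : Prop :=
  D (rr_point p q r g b) /\ rg_poly g2 p q r g b = 0.

Definition zero_point_with (P : R -> R -> R -> R -> R -> Prop) (u : R6) : Prop :=
  exists p q r g b, u = rr_point p q r g b /\ zero_point p q r g b /\ P p q r g b.

(** All five parameters may depend on t, since a perturbation of one parameter has to be compensated
    by another to stay on the zero set. *)
Lemma adherent_zero_curve (P : R -> R -> R -> R -> R -> Prop)
    (p q r g b : R -> R) :
  ex_derive p 0 -> ex_derive q 0 -> ex_derive r 0 -> ex_derive g 0 -> ex_derive b 0 ->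
  (forall d : posreal, exists t, Rabs t < d /\
     zero_point (p t) (q t) (r t) (g t) (b t) /\ P (p t) (q t) (r t) (g t) (b t)) ->
  adherent (zero_point_with P) (rr_point (p 0) (q 0) (r 0) (g 0) (b 0)).
Proof.
  intros Hp Hq Hr Hg Hb H.
  apply (adherent_curve _ (fun s => rr_point (p s) (q s) (r s) (g s) (b s))).
  - now apply continuous_rr_point.
  - intros d; destruct (H d) as (t & Ht & HZ).
    exists t; split; [exact Ht|].
    now exists (p t), (q t), (r t), (g t), (b t).
Qed.

(** At q = 0 the coefficient 2 q of b degenerates, so the perturbation q = t is compensated by
    another parameter: p if r = 0, and otherwise gamma3, whose coefficient 2 p r is then nonzero. *)
Lemma adherent_q_neq_0 (p q r g b : R) :
  zero_point p q r g b ->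
  adherent (zero_point_with (fun _ q _ _ _ => q <> 0)) (rr_point p q r g b).
Proof.
  intros HZ.
  destruct (Req_dec q 0) as [->|Hq]; [|apply adherent_in; now exists p, q, r, g, b].
  destruct HZ as [HD HG]; pose proof (rr_point_p_neq_0 _ _ _ _ _ HD) as Hp.
  destruct (Req_dec r 0) as [->|Hr].
  (* For r = 0, [rg_poly] is - 3 p^2 + q^2 + 2 q b + g2 / 4, so q = t requires p^2 to be replaced by
     p^2 k(t). *)
  - set (k := fun t => 1 + (t ^ 2 + 2 * t * b) / (3 * p ^ 2)).
    assert (Hk0 : k 0 = 1) by (unfold k; field; exact Hp).
    pose proof (adherent_zero_curve (fun _ q _ _ _ => q <> 0)
      (fun t => p * sqrt (k t)) (fun t => t) (fun _ => 0) (fun _ => g) (fun _ => b)) as H.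
    cbv beta in H; rewrite Hk0, sqrt_1, Rmult_1_r in H; apply H; clear H.
    + unfold k in *; auto_derive; lra.
    + apply ex_derive_id.
    + apply ex_derive_const.
    + apply ex_derive_const.
    + apply ex_derive_const.
    + intros d.
      (* Positivity of [k] near 0 serves twice: [sqrt] squares back to [k], and p keeps its sign. *)
      assert (Hk : locally 0 (fun t => 0 < k t)).
      { assert (Hc : continuous k 0).
        { apply (ex_derive_continuous (V := R_NormedModule)); unfold k; auto_derive; auto. }
        apply (Hc (fun y => 0 < y)), open_gt; lra. }
      destruct Hk as [d' Hd'].
      pose proof (cond_pos d); pose proof (cond_pos d').
      exists (Rmin d d' / 2).
      assert (Hm : 0 < Rmin d d') by (apply Rmin_pos; assumption).
      pose proof (Rmin_l d d'); pose proof (Rmin_r d d').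
      set (t := Rmin d d' / 2); assert (Ht : 0 < t < d /\ t < d') by (unfold t; lra).
      assert (Hkt : 0 < k t).
      { apply Hd'; change (Rabs (t - 0) < d'); rewrite Rminus_0_r, Rabs_pos_eq; lra. }
      split; [rewrite Rabs_pos_eq; lra|]; split; [split|lra].
      * revert HD; apply half_space_rr_point.
        pose proof (sqrt_lt_R0 _ Hkt).
        assert (0 < p * p) by nra; nra.
      * unfold rg_poly in *.
        replace ((p * sqrt (k t)) ^ 2) with (p ^ 2 * (sqrt (k t) * sqrt (k t))) by ring.
        rewrite sqrt_sqrt by lra.
        replace (p ^ 2 * k t) with (p ^ 2 + (t ^ 2 + 2 * t * b) / 3)
          by (unfold k; field; exact Hp).
        lra.
  (* The relation is solved for gamma3, in which it is affine with slope 2 p r. *)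
  - pose proof (adherent_zero_curve (fun _ q _ _ _ => q <> 0) (fun _ => p) (fun t => t)
      (fun _ => r) (fun t => g - (t ^ 2 * (1 - 2 * p * r ^ 2) + 2 * t * b) / (2 * p * r))
      (fun _ => b)) as H.
    cbv beta in H.
    replace (g - _) with g in H by (field; auto).
    apply H; clear H.
    + apply ex_derive_const.
    + apply ex_derive_id.
    + apply ex_derive_const.
    + auto_derive; auto.
    + apply ex_derive_const.
    + intros d; pose proof (cond_pos d); exists (d / 2).
      split; [rewrite Rabs_pos_eq; lra|]; split; [split|lra].
      * revert HD; apply half_space_rr_point; nra.
      * unfold rg_poly in *; rewrite <- HG; field; auto.
Qed.

Definition graph_b (p q r g : R) : R :=
  - (rg_poly g2 p q r g 0) / (2 * q).

Lemma rg_poly_graph_b (p q r g : R) : q <> 0 -> rg_poly g2 p q r g (graph_b p q r g) = 0.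
Proof. intros Hq; unfold graph_b, rg_poly; field; exact Hq. Qed.

(** [rg_poly] is affine in b with slope 2 q. *)
Lemma rg_poly_b_unique (p q r g b : R) :
  q <> 0 -> rg_poly g2 p q r g b = 0 -> b = graph_b p q r g.
Proof.
  intros Hq H.
  transitivity ((rg_poly g2 p q r g b - rg_poly g2 p q r g 0) / (2 * q)).
  - unfold rg_poly; field; exact Hq.
  - rewrite H; unfold graph_b; field; exact Hq.
Qed.

(** Where q is nonzero, r can be moved freely while b follows the graph. *)
Lemma adherent_r_neq_0 (p q r g b : R) :
  zero_point p q r g b -> q <> 0 ->
  adherent (zero_point_with (fun _ q r _ _ => q <> 0 /\ r <> 0)) (rr_point p q r g b).
Proof.
  intros HZ Hq.
  destruct (Req_dec r 0) as [->|Hr]; [|apply adherent_in; now exists p, q, r, g, b].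
  destruct HZ as [HD HG]; pose proof (rr_point_p_neq_0 _ _ _ _ _ HD) as Hp.
  rewrite (rg_poly_b_unique _ _ _ _ _ Hq HG).
  apply (adherent_zero_curve _ (fun _ => p) (fun _ => q) (fun t => t) (fun _ => g)
           (fun t => graph_b p q t g)).
  - apply ex_derive_const.
  - apply ex_derive_const.
  - apply ex_derive_id.
  - apply ex_derive_const.
  - unfold graph_b, rg_poly; auto_derive; auto.
  - intros d; pose proof (cond_pos d); exists (d / 2).
    split; [rewrite Rabs_pos_eq; lra|]; split; [split|split; [exact Hq|lra]].
    + revert HD; apply half_space_rr_point; nra.
    + now apply rg_poly_graph_b.
Qed.

Lemma adherent_nondegenerate (p q r g b : R) :
  zero_point p q r g b -> q <> 0 -> r <> 0 ->
  adherent (zero_point_with (fun p q r g b => r <> 0 /\ degeneracy p q r g b <> 0))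
    (rr_point p q r g b).
Proof.
  intros [HD HG] Hq Hr; pose proof (rr_point_p_neq_0 _ _ _ _ _ HD) as Hp.
  rewrite (rg_poly_b_unique _ _ _ _ _ Hq HG).
  pose proof (adherent_zero_curve
    (fun p q r g b => r <> 0 /\ degeneracy p q r g b <> 0)
    (fun _ => p) (fun _ => q) (fun _ => r) (fun t => g + t)
    (fun t => graph_b p q r (g + t))) as H.
  cbv beta in H; rewrite Rplus_0_r in H; apply H; clear H.
  - apply ex_derive_const.
  - apply ex_derive_const.
  - apply ex_derive_const.
  - auto_derive; auto.
  - unfold graph_b, rg_poly; auto_derive; auto.
  - intros d.
    (* At t = 0, e1 = a + i b0 and gamma3 + r x2^2 = A - i B; [m] is the slope of [graph_b] in
       gamma3. *)
    set (b0 := graph_b p q r g); set (A := g + r * (p ^ 2 - q ^ 2)); set (B := 2 * p * q * r).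
    set (a := 2 * p ^ 2 * r ^ 2 - 2 * p); set (m := - (p * r / q)).
    (* The coefficients of (b0 + m t) ((A + t)^2 - B^2) - 2 a (A + t) B in powers of t. *)
    destruct (cubic_frequently_neq_0
      (b0 * (A ^ 2 - B ^ 2) - 2 * a * A * B)
      (m * (A ^ 2 - B ^ 2) + 2 * A * b0 - 2 * a * B)
      (2 * A * m + b0) m d) as (t & Ht & HP).
    { unfold m; apply Ropp_neq_0_compat; unfold Rdiv.
      repeat apply Rmult_integral_contrapositive_currified; auto using Rinv_neq_0_compat. }
    exists t; split; [exact Ht|]; split; [split|split; [exact Hr|]].
    + revert HD; apply half_space_rr_point; nra.
    + now apply rg_poly_graph_b.
    + replace (degeneracy p q r (g + t) (graph_b p q r (g + t))) with
        (b0 * (A ^ 2 - B ^ 2) - 2 * a * A * B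
         + (m * (A ^ 2 - B ^ 2) + 2 * A * b0 - 2 * a * B) * t
         + (2 * A * m + b0) * t ^ 2 + m * t ^ 3); [exact HP|].
      unfold degeneracy, b0, A, B, a, m, graph_b, rg_poly; field; exact Hq.
Qed.

Lemma zero_set_independent_dense (u : R6) :
  zero_set D [fun_rr; fun_rg g2] u ->
  adherent (fun v => zero_set D [fun_rr; fun_rg g2] v /\
    independent_at [fun_rr; fun_rg g2; int_g3 g2; int_k2] (to_complex v)) u.
Proof.
  intros Hu.
  destruct (fun_rr_eq_0 u) as (p & q & r & g & b & ->).
  { now apply (half_space_nonsingular D hD), (proj1 Hu). }
  { exact (Forall_inv (proj2 Hu)). }
  pose proof (rr_point_p_neq_0 _ _ _ _ _ (proj1 Hu)) as Hp.
  apply zero_set_rr_point in Hu; [|exact Hp].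
  (* Each [clear] forgets the previous point, so that its parameter names can be reused for the
     nearby one. *)
  apply (adherent_trans _ _ _ (adherent_q_neq_0 _ _ _ _ _ Hu)); clear - hD.
  intros y (p & q & r & g & b & -> & HZ & Hq).
  apply (adherent_trans _ _ _ (adherent_r_neq_0 _ _ _ _ _ HZ Hq)); clear - hD.
  intros y (p & q & r & g & b & -> & HZ & Hq & Hr).
  apply (adherent_trans _ _ _ (adherent_nondegenerate _ _ _ _ _ HZ Hq Hr)); clear - hD.
  intros y (p & q & r & g & b & -> & HZ & Hr & Hd).
  pose proof (rr_point_p_neq_0 _ _ _ _ _ (proj1 HZ)) as Hp.
  apply adherent_in; split.
  - now apply zero_set_rr_point.
  - now apply rr_point_independent.
Qed.

End Density.

(** * The four relations and the invariant measure together *)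

Lemma Ceq_minus_0 (a b : C) : a = b <-> (a - b)%C = RtoC 0.
Proof.
  split; intros E.
  - rewrite E; ring.
  - transitivity (a - b + b)%C; [ring|rewrite E; ring].
Qed.

Theorem proposition1 (g2 : R) :
  forall D : R6 -> Prop, D = Hplus \/ D = Hminus ->
    simply_connected D /\
    invariant_set (vfield g2) nonsingular D /\
    invariant_relation (vfield g2) D rel_rr /\
    invariant_relation (vfield g2) D (rel_rg g2) /\
    (forall g3 : R, invariant_relation (vfield g2) D (rel_gg g2 g3)) /\
    (forall k : R, invariant_relation (vfield g2) D (rel_ee k)) /\
    completely_integrable_with (vfield g2) D mu
      [fun_rr; fun_rg g2] [int_g3 g2; int_k2].
Proof.
  intros D HD.
  assert (Hs : forall u, D u -> (to_complex u cx1 + to_complex u cx2)%C <> RtoC 0).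
  { intros u Hu; now apply sum_x_neq_0, (half_space_nonsingular D). }
  assert (Irr : first_integral (vfield g2) D fun_rr).
  { apply (first_integral_of_differential _ _ _ d_rr);
      auto using has_differential_rr, d_rr_vfield. }
  assert (Irg : first_integral (vfield g2) D (fun_rg g2)).
  { apply (first_integral_of_differential _ _ _ (d_rg g2));
      auto using has_differential_rg, d_rg_vfield. }
  assert (Ig3 : first_integral (vfield g2) D (int_g3 g2)).
  { apply (first_integral_of_differential _ _ _ (d_g3 g2));
      auto using has_differential_g3, d_g3_vfield. }
  assert (Ik2 : first_integral (vfield g2) D int_k2).
  { apply (first_integral_of_differential _ _ _ d_k2);
      auto using has_differential_k2, d_k2_vfield. }
  pose proof (fun f => invariant_relation_of_first_integral (vfield g2) D f 0) as Hzero.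
  split; [now apply half_space_simply_connected|].
  split; [now apply half_space_invariant|].
  split; [|split; [|split; [|split]]].
  - apply (Hzero fun_rr); [|exact Irr].
    intros z; unfold rel_rr, fun_rr; apply Ceq_minus_0.
  - apply (Hzero (fun_rg g2)); [|exact Irg].
    intros z; unfold rel_rg, fun_rg; apply Ceq_minus_0.
  (* The factor 2 in [int_g3] turns the term g3 / 2 of the relation into the value g3. *)
  - intros g3; apply (invariant_relation_of_first_integral _ _ (int_g3 g2) g3); [|exact Ig3].
    intros z; unfold rel_gg, int_g3.
    assert (RtoC 2 <> RtoC 0) by neq_0.
    split; intros E.
    + rewrite E; field; auto.
    + rewrite <- E; field; auto.
  - intros k; apply (invariant_relation_of_first_integral _ _ int_k2 (k ^ 2)%C); [|exact Ik2].
    reflexivity.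
  - split; [|split; [reflexivity|split; [|split]]].
    + intros u Hu; pose proof (half_space_nonsingular D HD u Hu) as Hp.
      (* On real phase space x1 + x2 = 2 p, so the density is real and positive on either side. *)
      assert (E : mu (to_complex u) = RtoC (/ (2 * coord_p u) ^ 2)).
      { unfold mu; rewrite sum_x_to_complex.
        rewrite RtoC_inv, RtoC_pow by auto using pow_nonzero, double_neq_0.
        unfold Cdiv; ring. }
      rewrite E; split; [reflexivity|]; split.
      * change (0 < / (2 * coord_p u) ^ 2); apply Rinv_0_lt_compat; rewrite <- Rsqr_pow2.
        now apply Rlt_0_sqr, double_neq_0.
      * now apply div_mu_vfield, Hs.
    + repeat constructor; now apply (Hzero _ _ (fun z => iff_refl _)).
    + repeat constructor; assumption.
    + intros u Hu eps.
      destruct (zero_set_independent_dense g2 D HD u Hu eps) as (v & Hv & HZ & HI).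
      now exists v.
Qed.
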